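(* Let $P\subset\mathbb R^n$ be a bounded open convex set and let $\phi\in L^1(P)$ be a convex function with $\int_P\phi\,d\mu=0$, where $\mu$ is Lebesgue measure. Then $$-\frac{2}{n+1}\left(\frac{n}{n+1}\right)^n\inf_P\phi\;\le\;\frac{1}{\mu(P)}\int_P|\phi|\,d\mu\;\le\;-2\inf_P\phi .$$ Both constants are sharp: for each $n$ the constant $\frac{2}{n+1}\left(\frac{n}{n+1}\right)^n$ cannot be replaced by a larger one and the constant $2$ cannot be replaced by a smaller one (in the class of all such pairs $P,\phi$ in $\mathbb R^n$).
   Context: $\mu$ denotes Lebesgue measure on $\mathbb R^n$. *)

(* Defs.v *)
From HB Require Import structures.
From mathcomp Require Import all_boot all_order all_algebra.
From mathcomp Require Import all_classical all_reals all_analysis.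
Set Implicit Arguments. Unset Strict Implicit. Unset Printing Implicit Defensive.
Import Order.TTheory GRing.Theory Num.Theory.
Import numFieldNormedType.Exports.
Local Open Scope classical_set_scope.
Local Open Scope ring_scope.

(* n-dimensional Lebesgue measure on the product (Borel) sigma-algebra of
   n.-tuple R, defined as the iterated (Tonelli) product of the 1-dimensional
   Lebesgue measure:  lebn 0 = Dirac mass at the empty tuple,
   lebn (m+1) A = \int_R lebn m {t | x :: t \in A} dx. *)
Fixpoint lebn (R : realType) (n : nat) : set (n.-tuple R) -> \bar R :=
  match n return set (n.-tuple R) -> \bar R with
  | 0 => fun A => if `[< A [tuple] >] then 1%E else 0%E
  | m.+1 => fun A =>
      (\int[@lebesgue_measure R]_x @lebn R m [set t | A (cons_tuple x t)])%E
  end.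

Definition rowt (R : realType) (n : nat) (t : n.-tuple R) : 'rV[R]_n :=
  \row_i tnth t i.

Definition lebRn (R : realType) (n : nat) (A : set 'rV[R]_n) : \bar R :=
  @lebn R n (@rowt R n @^-1` A).

Definition integralRn (R : realType) (n : nat) (A : set 'rV[R]_n)
    (f : 'rV[R]_n -> \bar R) : \bar R :=
  (\int[@lebn R n]_(t in @rowt R n @^-1` A) f (rowt t))%E.

Definition integrableRn (R : realType) (n : nat) (A : set 'rV[R]_n)
    (f : 'rV[R]_n -> R) : Prop :=
  (@lebn R n).-integrable (@rowt R n @^-1` A) (fun t => (f (rowt t))%:E).

(* Main.v *)
(** Since [phi] has mean zero, the integral of [|phi|] is twice that of the
    negative part [phi^-].  The upper bound is [phi^- <= - inf phi].  For the
    lower bound fix [y] in [P] and dilate [P] towards [y] with ratio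
    [k = n / (n + 1)]: integrating the convexity inequality
    [phi ((1 - k) y + k x) <= (1 - k) phi y + k phi x] over [x] in [P] and
    changing variables gives
    [\int phi^- >= k^n (1 - k) (- phi y) mu(P)] for every [y], which also shows
    that [phi] is bounded below.  Sharpness is witnessed on the unit ball of the
    sup norm by [phi x = a max(|x| - r, 0) - 1], with [r = 0] for the lower
    constant (where equality holds) and [r -> 1] for the upper one. *)
Require Import Defs.
From HB Require Import structures.
From mathcomp Require Import all_boot all_order all_algebra.
From mathcomp Require Import all_classical all_reals all_analysis.
From mathcomp Require Import measurable_realfun lra ring.
Set Implicit Arguments. Unset Strict Implicit. Unset Printing Implicit Defensive.
Import Order.TTheory GRing.Theory Num.Theory.
Import numFieldNormedType.Exports.
Local Open Scope classical_set_scope.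
Local Open Scope ring_scope.

(** * The iterated Lebesgue measure is a sigma-finite measure *)

Section lebn_measure.
Context {R : realType}.

Let consm m (z : measurableTypeR R * m.-tuple R) : m.+1.-tuple R :=
  cons_tuple z.1 z.2.

Let measurable_consm m : measurable_fun setT (@consm m).
Proof. by apply: (@measurable_cons _ _ _ R) => //; exact: measurable_fst. Qed.

Let unconsm m (t : m.+1.-tuple R) : measurableTypeR R * m.-tuple R :=
  (thead t, behead_tuple t).

Let measurable_unconsm m : measurable_fun setT (@unconsm m).
Proof.
apply/measurable_fun_pairP; split.
  exact: (@measurable_tnth _ R m.+1 ord0).
exact: measurable_behead.
Qed.

Let consmK m : cancel (@consm m) (@unconsm m).
Proof.
by case=> x t; rewrite /unconsm /consm /= theadE; congr pair; exact: val_inj.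
Qed.

Let lebnS m (nu : {sigma_finite_measure set (m.-tuple R) -> \bar R}) :
  @lebn R m = nu ->
  @lebn R m.+1 = pushforward (@lebesgue_measure R \x nu)%E (@consm m).
Proof.
move=> nuE; apply/funext => A /=; rewrite /pushforward /product_measure1.
apply: eq_integral => x _ /=; rewrite nuE; congr (nu _).
by apply/seteqP; split=> t /=; rewrite xsectionE.
Qed.

(** By induction on the dimension: [lebn] in dimension [m.+1] is the image, under prepending a
    coordinate, of the product of Lebesgue measure with [lebn] in dimension [m]. Sigma-finiteness is
    carried along because it is what allows the product to be formed at the next stage. *)
Lemma lebn_sigma_finite_measure m :
  exists nu : {sigma_finite_measure set (m.-tuple R) -> \bar R}, @lebn R m = nu.
Proof.
elim: m => [|m [nu nuE]].
  exists (@dirac _ (0.-tuple R) [tuple] R); apply/funext => A /=.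
  rewrite /dirac /= indicE; case: ifPn => /asboolP; first by move=> ?; rewrite mem_set.
  by move=> ?; rewrite memNset.
pose mu := pushforward (@lebesgue_measure R \x nu)%E (@consm m).
have smu : sigma_finite setT mu.
  have /sigma_finiteP[F [TF ndF Foo]] := sigma_finiteT (@lebesgue_measure R).
  have /sigma_finiteP[G [TG ndG Goo]] := sigma_finiteT nu.
  (* Both exhaustions are nondecreasing, so the diagonal boxes already cover: a point in [F i] and
     [G j] lies in the box of index [maxn i j]. *)
  exists (fun k => @unconsm m @^-1` (F k `*` G k)).
    apply/esym; rewrite -subTset => t _.
    have [i _ Fi] : (\bigcup_i F i) (thead t) by rewrite -TF.
    have [j _ Gj] : (\bigcup_i G i) (behead_tuple t) by rewrite -TG.
    exists (maxn i j) => //; split => /=.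
      by apply: (subsetPset _ _ (ndF _ _ (leq_maxl i j))).
    by apply: (subsetPset _ _ (ndG _ _ (leq_maxr i j))).
  move=> k; have [mF Fk] := Foo k; have [mG Gk] := Goo k; split.
    by rewrite -[_ @^-1` _]setTI; apply: measurable_unconsm => //; exact: measurableX.
  rewrite /mu /pushforward -comp_preimage (_ : _ \o _ = id); last first.
    by apply/funext => z /=; exact: consmK.
  by rewrite preimage_id product_measure1E// lte_mul_pinfty// ge0_fin_numE.
pose nuS := HB.pack_for {sigma_finite_measure set (m.+1.-tuple R) -> \bar R} mu
  (Measure_isSigmaFinite.Build _ _ _ _ smu).
exists (nuS (@measurable_consm m) (@measurable_consm m) (@measurable_consm m)).
exact: lebnS.
Qed.

Lemma lebn_set0 m : @lebn R m set0 = 0%E.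
Proof. by have [nu ->] := lebn_sigma_finite_measure m; exact: measure0. Qed.

Lemma lebn_ge0 m A : (0 <= @lebn R m A)%E.
Proof. by have [nu ->] := lebn_sigma_finite_measure m; exact: measure_ge0. Qed.

Lemma lebn_semi_sigma_additive m : semi_sigma_additive (@lebn R m).
Proof.
by have [nu ->] := lebn_sigma_finite_measure m; exact: measure_semi_sigma_additive.
Qed.

HB.instance Definition _ m := isMeasure.Build _ _ _ (@lebn R m)
  (lebn_set0 m) (@lebn_ge0 m) (@lebn_semi_sigma_additive m).

Lemma lebn_sigma_finite m : sigma_finite setT (@lebn R m).
Proof. by have [nu ->] := lebn_sigma_finite_measure m; exact: sigma_finiteT. Qed.

HB.instance Definition _ m := Measure_isSigmaFinite.Build _ _ _ (@lebn R m)
  (@lebn_sigma_finite m).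

(** Makes the integrand in the recursive clause of [lebn] measurable, as the change of variables in
    the first coordinate demands. *)
Lemma measurable_lebn_section m (A : set (m.+1.-tuple R)) : measurable A ->
  measurable_fun [set: measurableTypeR R]
    ((fun x => @lebn R m [set t | A (cons_tuple x t)]) : measurableTypeR R -> \bar R).
Proof.
move=> mA.
have mcA : measurable (@consm m @^-1` A).
  by rewrite -[_ @^-1` _]setTI; exact: measurable_consm.
have := measurable_fun_xsection (@lebn R m) mcA.
congr measurable_fun; apply/funext => x /=; congr lebn.
by apply/seteqP; split=> t /=; rewrite xsectionE.
Qed.

End lebn_measure.

(** * Affine change of variables on the line *)

Section lebesgue_measure_affine.
Context {R : realType}.
Let mR := measurableTypeR R.

Lemma measurable_affine (a k : R) :
  measurable_fun setT (fun x : mR => a + k * x : mR).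
Proof.
apply: (@measurable_funD _ mR R) => //; exact: (@measurable_funM _ mR R).
Qed.

(** By uniqueness of Lebesgue measure: [k] times its image under the affine map is a measure that
    gives every half-open interval its length. *)
Lemma lebesgue_measure_affine (a k : R) (A : set mR) : 0 < k -> measurable A ->
  lebesgue_measure ((fun x : mR => a + k * x : mR) @^-1` A) =
  (k^-1%:E * lebesgue_measure A)%E.
Proof.
move=> k0 mA.
pose f := fun x : mR => a + k * x : mR.
have mf : measurable_fun setT f by exact: measurable_affine.
pose mu := mscale (NngNum (ltW k0)) (pushforward (@lebesgue_measure R) f).
suff -> : lebesgue_measure A = mu mf A.
  by rewrite /mu /mscale /= muleA -EFinM mulVf ?gt_eqF// mul1e.
apply: (lebesgue_measure_unique (mu := mu mf)) mA => _ [[c d]] _ <-.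
rewrite [RHS](_ : _ =
  (k%:E * lebesgue_measure `]((c - a) / k)%R, ((d - a) / k)%R]%classic)%E); last first.
  rewrite /mu /mscale /= /pushforward; congr (_ * lebesgue_measure _)%E.
  apply/seteqP; split=> x /=; rewrite /f !in_itv/= ltr_pdivrMr// ler_pdivlMr//;
    by rewrite ltrBlDl lerBrDl (mulrC x).
rewrite !lebesgue_measure_itv/= !lte_fin ltr_pM2r ?invr_gt0// ltrBlDr subrK.
case: ifPn => _; last by rewrite mule0.
by rewrite -!EFinB -EFinM -mulrBl mulrCA divff ?gt_eqF// mulr1 opprB addrA subrK.
Qed.

Lemma ge0_integral_affine (a k : R) (f : mR -> \bar R) : 0 < k ->
  measurable_fun setT f -> (forall x, 0 <= f x)%E ->
  (\int[lebesgue_measure]_x f (a + k * x)%R =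
   k^-1%:E * \int[lebesgue_measure]_x f x)%E.
Proof.
move=> k0 mf f0.
have ma := measurable_affine a k.
have kV0 : 0 <= k^-1 by rewrite invr_ge0 ltW.
have /= <- := ge0_integral_mscale lebesgue_measure measurableT (NngNum kV0) mf
  (fun x _ => f0 x).
have /= := ge0_integral_pushforward ma lebesgue_measure measurableT mf (fun x _ => f0 x).
rewrite preimage_setT => <-.
by apply: eq_measure_integral => A mA _; exact: lebesgue_measure_affine.
Qed.

End lebesgue_measure_affine.

(** * Dilations of n-space and their effect on volume *)

Section lebn_affine.
Context {R : realType}.

Definition afft n (a : n.-tuple R) (k : R) (t : n.-tuple R) : n.-tuple R :=
  [tuple tnth a i + k * tnth t i | i < n].

Lemma measurable_afft n (a : n.-tuple R) k : measurable_fun setT (afft a k).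
Proof.
apply/measurable_fun_tnthP => i.
rewrite (_ : _ \o _ = fun t => tnth a i + k * tnth t i); last first.
  by apply/funext => t /=; rewrite tnth_mktuple.
apply: measurable_funD => //; apply: measurable_funM => //.
exact: measurable_tnth.
Qed.

Lemma afft_cons n (a : n.+1.-tuple R) k x (t : n.-tuple R) :
  afft a k (cons_tuple x t) =
  cons_tuple (thead a + k * x) (afft (behead_tuple a) k t).
Proof.
apply: eq_from_tnth => i; rewrite tnth_mktuple.
case: (unliftP ord0 i) => [j ->|->]; last by rewrite !tnth0.
rewrite !tnthS tnth_mktuple [in LHS](tuple_eta a) tnthS.
by congr (tnth _ _ + _); exact: val_inj.
Qed.

(** Slicing along the first coordinate: each slice is dilated in dimension [n] and gives [k ^- n] by
    induction, while the affine substitution in the first coordinate gives the remaining factor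
    [k^-1]. *)
Lemma lebn_afft n (a : n.-tuple R) k (A : set (n.-tuple R)) : 0 < k ->
  measurable A -> lebn (afft a k @^-1` A) = ((k ^- n)%:E * lebn A)%E.
Proof.
move=> k0; elim: n a A => [a A mA|n IH a A mA].
  rewrite expr0 invr1 mul1e /=; congr (if `[< A _ >] then _ else _).
  by rewrite tuple0.
have mAx x : measurable [set t : n.-tuple R | A (cons_tuple x t)].
  have mc : measurable_fun setT (fun t : n.-tuple R => cons_tuple x t).
    exact: measurable_cons.
  by have := mc measurableT _ mA; rewrite setTI.
rewrite /=; under eq_integral => x _.
  rewrite (_ : [set t | _] = afft (behead_tuple a) k @^-1`
      [set t | A (cons_tuple (thead a + k * x) t)]); last first.
    by apply/seteqP; split=> t /=; rewrite afft_cons.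
  rewrite IH//.
  over.
rewrite /=.
have mg := measurable_lebn_section mA.
have kV0 : 0 <= k ^- n by rewrite invr_ge0 exprn_ge0// ltW.
rewrite ge0_integralZl//=; last first.
  exact: (measurableT_comp mg (measurable_affine (thead a) k)).
rewrite (ge0_integral_affine _ k0 mg)//.
by rewrite muleA -EFinM exprSr invfM mulrC.
Qed.

End lebn_affine.

(** * Change of variables in n-space, measurability of open sets, volume of balls *)

Section lebn_integral.
Context {R : realType}.

Lemma ge0_integral_afft n (a : n.-tuple R) k (f : n.-tuple R -> \bar R) :
  0 < k -> measurable_fun setT f -> (forall t, 0 <= f t)%E ->
  (\int[@lebn R n]_t f (afft a k t) = (k ^- n)%:E * \int[@lebn R n]_t f t)%E.
Proof.
move=> k0 mf f0.
have ma := measurable_afft a k.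
have kV0 : 0 <= k ^- n by rewrite invr_ge0 exprn_ge0// ltW.
have /= <- := ge0_integral_mscale (@lebn R n) measurableT (NngNum kV0) mf
  (fun x _ => f0 x).
have /= := ge0_integral_pushforward ma (@lebn R n) measurableT mf (fun x _ => f0 x).
rewrite preimage_setT => <-.
by apply: eq_measure_integral => A mA _; exact: lebn_afft.
Qed.

Lemma rowt_afft n (a : n.-tuple R) k t :
  rowt (afft a k t) = rowt a + k *: rowt t.
Proof. by apply/rowP => i; rewrite !mxE tnth_mktuple. Qed.

Lemma rowt_surj n (x : 'rV[R]_n) : exists t, rowt t = x.
Proof.
exists [tuple x ord0 i | i < n].
by apply/rowP => i; rewrite mxE tnth_mktuple.
Qed.

Lemma ball_rowE n (x y : 'rV[R]_n) e : 0 < e ->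
  ball x e y <-> forall i, `|x ord0 i - y ord0 i| < e.
Proof.
move=> e0; split=> [[_ xy] i|xy]; first exact: xy.
by split=> // i j; rewrite ord1; exact: xy.
Qed.

Lemma measurable_coord_ball n (c : 'I_n -> R) e :
  measurable [set t : n.-tuple R | forall i, `|c i - tnth t i| < e].
Proof.
rewrite (_ : [set t | _] = \bigcap_(i in [set: 'I_n])
    ((fun t : n.-tuple R => `|c i - tnth t i|) @^-1` `]-oo, e[)); last first.
  by apply/seteqP; split=> t /= h i; [move=> _|];
    have := h i; rewrite /= in_itv/=; [|apply].
apply: fin_bigcap_measurable => // i _.
rewrite -[_ @^-1` _]setTI; apply: (_ : measurable_fun setT _) => //.
apply: measurableT_comp => //; apply: measurable_funB => //.
exact: measurable_tnth.
Qed.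

(** Links the topology of row vectors to the product sigma-algebra on tuples: an open set is the
    countable union of the cubes with rational center and radius [1 / (k + 1)] that it contains. *)
Lemma measurable_rowt_open n (P : set 'rV[R]_n) :
  open P -> measurable (@rowt R n @^-1` P).
Proof.
move=> oP.
pose C (q : n.-tuple rat) (k : nat) : set (n.-tuple R) :=
  [set t | forall i, `|ratr (tnth q i) - tnth t i| < k.+1%:R^-1].
rewrite (_ : _ @^-1` _ = \bigcup_(qk : n.-tuple rat * nat)
   (if `[< C qk.1 qk.2 `<=` @rowt R n @^-1` P >] then C qk.1 qk.2 else set0)).
  apply: countable_bigcupT_measurable => [|[q k]]; first exact: countableP.
  case: ifPn => _ //; exact: measurable_coord_ball.
apply/seteqP; split=> [t Pt|t [[q k] _]]; last first.
  by case: ifPn => // /asboolP CP Ct; exact: CP.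
have /nbhs_ballP[e /= e0 eP] : nbhs (rowt t) P by exact: open_nbhs_nbhs.
(* Half of [e] suffices: the point and any other element of the cube are each within [1 / (k + 1)]
   of the rational center. *)
have [k ke] : exists k : nat, k.+1%:R^-1 < e / 2 :> R.
  have /ltr_add_invr[k] : 0 < e / 2 by rewrite divr_gt0.
  by rewrite add0r; exists k.
have k0 : 0 < k.+1%:R^-1 :> R by rewrite invr_gt0.
have /choice[q qP] : forall i, exists q : rat, `|ratr q - tnth t i| < k.+1%:R^-1.
  move=> i; have [|q] := @rat_in_itvoo R (tnth t i - k.+1%:R^-1) (tnth t i + k.+1%:R^-1).
    by rewrite ltrD2l gtrN.
  by rewrite in_itv/= -ltr_distl => ?; exists q.
exists ([tuple q i | i < n], k) => //=.
have Ct : C [tuple q i | i < n] k t by move=> i; rewrite tnth_mktuple.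
case: ifPn => // /asboolP []; move=> s Cs /=; apply: eP.
apply/ball_rowE => // i; rewrite !mxE.
rewrite (le_lt_trans (ler_distD (ratr (q i)) _ _))// [ltRHS]splitr.
rewrite ltrD ?(lt_trans _ ke)//; first by rewrite distrC.
by have := Cs i; rewrite tnth_mktuple.
Qed.

Lemma lebn_coord_ball1 n :
  @lebn R n [set t | forall i, `|0 - tnth t i| < 1] = (2 ^+ n)%:E.
Proof.
elim: n => [|n IH] /=.
  by case: ifPn => // /asboolP[]; case.
(* The slice at [x] is the cube of one dimension less when [|x| < 1], and is empty otherwise. *)
transitivity (\int[@lebesgue_measure R]_(x in `](-1)%R, 1%R[) (2 ^+ n)%:E)%E; last first.
  rewrite integral_cst//= lebesgue_measure_itv/= lte_fin gtrN// -EFinB -EFinM.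
  by rewrite opprK exprSr.
rewrite [RHS]integral_mkcond; apply: eq_integral => x _.
rewrite patchE; case: ifPn => [|].
  rewrite inE/= in_itv/= => xI; rewrite -IH; congr lebn.
  apply/seteqP; split=> t /= h i; first by have := h (lift ord0 i); rewrite tnthS.
  case: (unliftP ord0 i) => [j ->|->]; first by rewrite tnthS.
  by rewrite tnth0 sub0r normrN ltr_norml.
rewrite notin_setE/= in_itv/= => xI; rewrite (_ : [set t | _] = set0) ?measure0//.
apply/seteqP; split=> t //= /(_ ord0); rewrite tnth0 sub0r normrN ltr_norml.
by move/xI.
Qed.

(** Balls of the sup norm are cubes, and this one is the preimage of the unit cube under the
    dilation of ratio [e^-1] that sends [x] to the origin. *)
Lemma lebn_ball n (x : 'rV[R]_n) e : 0 < e ->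
  lebn (@rowt R n @^-1` ball x e) = ((2 * e) ^+ n)%:E.
Proof.
move=> e0; have [a ax] := rowt_surj (- e^-1 *: x).
have eV0 : 0 < e^-1 by rewrite invr_gt0.
have := lebn_afft a eV0 (measurable_coord_ball (fun=> 0) 1).
rewrite lebn_coord_ball1 -EFinM -exprVn invrK -exprMn mulrC => <-; congr lebn.
apply/seteqP; split=> t /=; rewrite ball_rowE// => xt i; have := xt i;
  have := congr1 (fun y : 'rV_n => y ord0 i) ax; rewrite tnth_mktuple !mxE => ->;
  by rewrite sub0r opprD mulNr opprK -mulrBr normrM gtr0_norm// ltr_pdivrMl// mulr1.
Qed.

End lebn_integral.

(** * The negative part and comparison of integrals *)

Section negative_part.
Context {d : measure_display} {T : measurableType d} {R : realType}.
Variable mu : {measure set T -> \bar R}.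

Lemma bound_integrable (D : set T) (f : T -> R) (M : R) :
  measurable D -> (mu D < +oo)%E -> measurable_fun D f ->
  (forall t, D t -> `|f t| <= M) -> mu.-integrable D (EFin \o f).
Proof.
move=> mD Doo mf fM; apply: measurable_bounded_integrable => //.
exists M; split; first exact: num_real.
by move=> x Mx t Dt; exact: le_trans (fM _ Dt) (ltW Mx).
Qed.

Definition negp (f : T -> R) (t : T) : R := Num.max (- f t) 0.

Lemma negp_ge0 f t : 0 <= negp f t.
Proof. by rewrite /negp le_max lexx orbT. Qed.

Lemma negp_ge f t : - f t <= negp f t.
Proof. by rewrite /negp le_max lexx. Qed.

Lemma normr_negp f t : `|f t| = f t + 2 * negp f t.
Proof.
rewrite /negp; have [f0|f0] := leP 0 (f t).
  by rewrite max_r ?oppr_le0// ger0_norm// mulr0 addr0.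
by rewrite max_l ?oppr_ge0 1?ltW// ltr0_norm//; ring.
Qed.

Variables (D : set T) (f : T -> R).
Hypotheses (mD : measurable D) (intf : mu.-integrable D (EFin \o f)).

Lemma measurable_negp : measurable_fun D (negp f).
Proof.
have /measurable_int/measurable_EFinP mf := intf.
by apply: measurable_maxr => //; exact: measurableT_comp.
Qed.

Lemma integrable_negp : mu.-integrable D (EFin \o negp f).
Proof.
apply: (le_integrable mD _ _ intf).
  exact/measurable_EFinP/measurable_negp.
move=> t Dt /=; rewrite lee_fin (ger0_norm (negp_ge0 _ _)) /negp ge_max normr_ge0 andbT.
by rewrite -normrN ler_norm.
Qed.

Lemma integral_norm_negp : (\int[mu]_(t in D) (f t)%:E = 0)%E ->
  (\int[mu]_(t in D) `|f t|%:E = 2%:E * \int[mu]_(t in D) (negp f t)%:E)%E.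
Proof.
move=> f0; under eq_integral do rewrite normr_negp EFinD EFinM.
rewrite integralD//; last by apply: integrableZl => //; exact: integrable_negp.
by rewrite f0 add0e integralZl//; exact: integrable_negp.
Qed.

Lemma integral_negp_le (m : R) : m <= 0 -> (forall t, D t -> m <= f t) ->
  (\int[mu]_(t in D) (negp f t)%:E <= (- m)%:E * mu D)%E.
Proof.
move=> m0 mf; rewrite -integral_cst//.
apply: ge0_le_integral => //.
- by move=> t _; rewrite lee_fin negp_ge0.
- exact/measurable_EFinP/measurable_negp.
- by move=> t Dt; rewrite lee_fin /negp ge_max lerN2 mf// oppr_ge0.
Qed.

(** Here [f] may change sign and [g] may have infinite integral, so the comparison passes through
    the positive part of [f]. *)
Lemma le_integral_ge0 (g : T -> \bar R) : measurable_fun D g ->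
  (forall t, D t -> 0 <= g t)%E -> (forall t, D t -> (f t)%:E <= g t)%E ->
  (\int[mu]_(t in D) (f t)%:E <= \int[mu]_(t in D) g t)%E.
Proof.
move=> mg g0 fg; rewrite integralE.
have /measurable_int mf := intf.
apply: (@le_trans _ _ (\int[mu]_(t in D) (EFin \o f)^\+ t)%E).
  by rewrite leeBlDr ?leeDl ?integral_ge0// ?integrable_neg_fin_num.
apply: ge0_le_integral => //; first exact: measurable_funepos.
by move=> t Dt; rewrite funeposE ge_max fg//= g0.
Qed.

End negative_part.

(** * The integral inequality obtained from a dilation *)

Section dilation.
Context {R : realType}.

(** Extend the negative part by zero to [g]. By change of variables the right-hand side is the
    integral of [g] composed with the dilation over the whole space; restricted to [D], this
    dominates the integral of [- c - k * f], in which the second term has integral zero. *)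
Lemma integral_negp_dilation n (D : set (n.-tuple R)) (f : n.-tuple R -> R)
    (a : n.-tuple R) (k c : R) :
  measurable D -> (lebn D < +oo)%E -> (@lebn R n).-integrable D (EFin \o f) ->
  (\int[@lebn R n]_(t in D) (f t)%:E = 0)%E -> 0 < k ->
  (forall t, D t -> D (afft a k t)) ->
  (forall t, D t -> f (afft a k t) <= c + k * f t) ->
  ((- c)%:E * lebn D <= (k ^- n)%:E * \int[@lebn R n]_(t in D) (negp f t)%:E)%E.
Proof.
move=> mD Doo intf f0 k0 aD fa.
pose g : n.-tuple R -> \bar R := (EFin \o negp f) \_ D.
have g0 t : (0 <= g t)%E.
  by rewrite /g patchE; case: ifPn => // _; rewrite lee_fin negp_ge0.
have mg : measurable_fun setT g.
  by apply/(measurable_restrictT _ mD)/measurable_EFinP; exact: measurable_negp intf.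
rewrite [X in (_ <= _ * X)%E]integral_mkcond -(ge0_integral_afft a k0 mg g0).
have mga : measurable_fun setT (g \o afft a k).
  exact: (measurableT_comp mg (measurable_afft a k)).
have intc : (@lebn R n).-integrable D (EFin \o cst (- c)).
  by apply: (bound_integrable (M := `|c|)) => // t _ /=; rewrite normrN.
have intkf : (@lebn R n).-integrable D (EFin \o (fun t => - k * f t)).
  rewrite (_ : _ \o _ = fun t => (- k)%:E * (f t)%:E)%E; first exact: integrableZl.
  by apply/funext => t /=; rewrite EFinM.
apply: (@le_trans _ _ (\int[@lebn R n]_(t in D) (- c + - k * f t)%:E)%E).
  under eq_integral do rewrite EFinD.
  rewrite integralD// integral_cst//.
  under [X in (_ + X)%E]eq_integral do rewrite EFinM.
  by rewrite integralZl// f0 mule0 adde0.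
apply: (@le_trans _ _ (\int[@lebn R n]_(t in D) (g \o afft a k) t)%E).
  apply: le_integral_ge0 => //.
  - have := integrableD mD intc intkf; apply: eq_integrable => //.
  - exact: measurable_funTS.
  - by move=> t _; exact: g0.
  move=> t Dt /=; rewrite /g patchE mem_set/=; last exact: aD.
  rewrite lee_fin; apply: (le_trans _ (negp_ge f _)). by rewrite mulNr -opprD lerN2 fa.
by apply: ge0_subset_integral => // t _; exact: g0.
Qed.

End dilation.

(** * Volume of the domain, and convexity with real weights *)

Section convex_bounds.
Context {R : realType}.
Variables (n : nat) (P : set 'rV[R]_n) (phi : 'rV[R]_n -> R).

Let D := @rowt R n @^-1` P.

(** Some ball lies inside [P] and another contains it. A real value [L] allows division by the
    volume in ordinary arithmetic. *)
Lemma lebRn_bounded_open : open P -> bounded_set P -> P !=set0 ->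
  exists2 L : R, 0 < L & lebRn P = L%:E.
Proof.
move=> oP bP [x Px].
have mD : measurable D by exact: measurable_rowt_open.
have [e /= e0 eP] : nbhs_ball x P by apply/nbhs_ballP; exact: open_nbhs_nbhs.
have L0 : (0 < lebRn P)%E.
  apply: (@lt_le_trans _ _ (lebn (@rowt R n @^-1` ball x e))).
    by rewrite lebn_ball// lte_fin exprn_gt0// mulr_gt0.
  apply: le_measure; rewrite ?inE//.
    by apply: measurable_rowt_open; exact: ball_open.
  by move=> t /eP.
have Loo : (lebRn P < +oo)%E.
  have [M [_ /(_ (`|M| + 1))]] := bP.
  rewrite (le_lt_trans (ler_norm _)) ?ltrDl// => /(_ erefl) PM.
  have M0 : 0 < `|M| + 2 by rewrite ltr_wpDl.
  apply: (@le_lt_trans _ _ (lebn (@rowt R n @^-1` ball 0 (`|M| + 2)))).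
    apply: le_measure; rewrite ?inE//.
      by apply: measurable_rowt_open; exact: ball_open.
    move=> t /PM /= tM; rewrite -ball_normE/= sub0r normrN.
    by rewrite (le_lt_trans tM)// ltrD2l ltr1n.
  by rewrite lebn_ball// ltry.
exists (fine (lebRn P)); first by rewrite fine_gt0// L0.
by rewrite fineK// ge0_fin_numE// ltW.
Qed.

Hypotheses (cP : convex_set P) (cphi : convex_function P phi).

(** The order of the terms fits a dilation of ratio [k] applied to [x] with translation part
    [(1 - k) *: y]. *)
Lemma convex_set_comb x y (k : R) : 0 <= k <= 1 -> P x -> P y ->
  P ((1 - k) *: y + k *: x).
Proof.
move=> /andP[k0 k1] Px Py.
have := cP (Itv01 k0 k1) (mem_set Px) (mem_set Py).
by rewrite inE addrC.
Qed.

Lemma convex_function_comb x y (k : R) : 0 <= k <= 1 -> P x -> P y ->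
  phi ((1 - k) *: y + k *: x) <= (1 - k) * phi y + k * phi x.
Proof.
move=> /andP[k0 k1] Px Py.
have := @cphi (Itv01 k0 k1) _ _ (mem_set Px) (mem_set Py).
by rewrite addrC [leRHS]addrC.
Qed.

End convex_bounds.

(** * The two-sided estimate *)

Section mean_oscillation.
Context {R : realType}.
Variables (n : nat) (P : set 'rV[R]_n) (phi : 'rV[R]_n -> R).
Hypotheses (oP : open P) (bP : bounded_set P) (P0 : P !=set0).
Hypotheses (intphi : integrableRn P phi)
  (phi0 : integralRn P (fun x => (phi x)%:E) = 0%E).

Let D := @rowt R n @^-1` P.
Let f := phi \o @rowt R n.

(** Reduces the estimates to real numbers: the volume [L] and the integral [N] of the negative part
    determine the average of the absolute value. *)
Lemma avg_negp : exists L N : R, [/\ 0 < L, lebRn P = L%:E,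
  (\int[@lebn R n]_(t in D) (negp f t)%:E)%E = N%:E &
  ((lebRn P)^-1 * integralRn P (fun x => (`|phi x|)%:E))%E = (2 * N / L)%:E].
Proof.
have mD : measurable D by exact: measurable_rowt_open.
have [L L0 PL] := lebRn_bounded_open oP bP P0.
exists L, (fine (\int[@lebn R n]_(t in D) (negp f t)%:E)%E).
have NE : ((fine (\int[@lebn R n]_(t in D) (negp f t)%:E))%:E =
    \int[@lebn R n]_(t in D) (negp f t)%:E)%E.
  by rewrite fineK//; apply: integrable_fin_num => //; exact: integrable_negp.
split=> //; rewrite PL inver gt_eqF// /integralRn.
by rewrite (integral_norm_negp mD intphi phi0) -/f -/D -NE -!EFinM mulrC.
Qed.

Hypotheses (cP : convex_set P) (cphi : convex_function P phi).

Lemma mean_oscillation_bounds : (0 < n)%N ->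
  ((- (2 / n.+1%:R * (n%:R / n.+1%:R) ^+ n) * inf (phi @` P))%:E <=
    (lebRn P)^-1 * integralRn P (fun x => (`|phi x|)%:E) <=
    (- 2 * inf (phi @` P))%:E)%E.
Proof.
move=> n0; have mD : measurable D by exact: measurable_rowt_open.
have [L [N [L0 PL NE ->]]] := avg_negp.
(* This ratio maximizes [k ^+ n * (1 - k)] on the unit interval. *)
set k : R := n%:R / n.+1%:R.
have n1 : 0 < n.+1%:R :> R by rewrite ltr0n.
have k0 : 0 < k by rewrite divr_gt0// ltr0n.
have k1 : 1 - k = n.+1%:R^-1.
  by rewrite /k -[X in X - _](@divff _ n.+1%:R) ?gt_eqF//
    -mulrBl -natrB// subSn// subnn mul1r.
have kle1 : 0 <= k <= 1 by rewrite ltW//= -subr_ge0 k1 invr_ge0 ltW.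
have kn0 : 0 < k ^+ n by rewrite exprn_gt0.
(* The dilation towards [y] maps [P] into itself, and convexity supplies the additive constant
   [(1 - k) * phi y]. *)
have key y : P y -> n.+1%:R^-1 * k ^+ n * - phi y * L <= N.
  move=> Py; have [a ay] := rowt_surj ((1 - k) *: y).
  have := @integral_negp_dilation R n D f a k ((1 - k) * phi y) mD.
  rewrite [lebn D]PL ltry => /(_ erefl intphi phi0 k0).
  rewrite NE -!EFinM lee_fin => /(_ _ _).
  have aD t : D t -> D (afft a k t).
    by move=> Dt; rewrite /D /= rowt_afft ay; exact: convex_set_comb.
  have fa t : D t -> f (afft a k t) <= (1 - k) * phi y + k * f t.
    by move=> Dt; rewrite /f /= rowt_afft ay; exact: (convex_function_comb cphi).
  move=> /(_ aD fa); rewrite mulrC -[leRHS]mulrC ler_pdivlMr// k1; apply: le_trans.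
  by rewrite le_eqVlt; apply/orP; left; apply/eqP; ring.
have c0 : 0 < n.+1%:R^-1 * k ^+ n by rewrite mulr_gt0// invr_gt0.
(* This is [key] solved for [phi y]. It bounds [phi] from below, so [inf] is a true infimum and not
   a default value, and [m <= inf] is already the lower estimate. *)
pose m := - (N / (n.+1%:R^-1 * k ^+ n * L)).
have lbm : lbound (phi @` P) m.
  move=> _ [y Py <-]; rewrite /m lerNl ler_pdivlMr ?mulr_gt0//.
  by rewrite mulrCA mulrA; exact: key.
have PhiN0 : phi @` P !=set0 by case: P0 => x Px; exists (phi x), x.
have minf := lb_le_inf PhiN0 lbm.
have inff y : P y -> inf (phi @` P) <= phi y.
  by move=> Py; apply: ge_inf; [exists m|exists y].
set i := inf _ in minf inff *.
(* A positive infimum would make the integral of [phi] at least [i * L], hence positive. *)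
have i0 : i <= 0.
  rewrite leNgt; apply/negP => ipos.
  have : (\int[@lebn R n]_(t in D) (cst i%:E t) <= \int[@lebn R n]_(t in D) (f t)%:E)%E.
    apply: ge0_le_integral => //; first by move=> ? _; rewrite lee_fin ltW.
      by have /measurable_int := intphi.
    by move=> t Dt; rewrite lee_fin inff.
  rewrite integral_cst//= [lebn D]PL -EFinM [leRHS]phi0 lee_fin.
  by rewrite leNgt mulr_gt0.
apply/andP; split; rewrite lee_fin.
  have H : - i * (n.+1%:R^-1 * k ^+ n * L) <= N.
    by rewrite -ler_pdivlMr ?mulr_gt0// lerNl.
  rewrite ler_pdivlMr//; apply: le_trans (ler_wpM2l (ler0n R 2) H).
  by rewrite le_eqVlt; apply/orP; left; apply/eqP; ring.
have := integral_negp_le mD intphi i0 (fun t Dt => inff _ Dt).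
rewrite NE /= [lebn D]PL -EFinM lee_fin => H.
by rewrite ler_pdivrMr// mulNr -mulrN -mulrA ler_pM2l.
Qed.

End mean_oscillation.

(** * Powers of numbers tending to 1 from the left *)

Lemma exprn_lt1_approx {R : realType} n (c : R) : c < 1 ->
  exists2 s : R, 0 < s < 1 & c < s ^+ n.
Proof.
move=> c1; near (1:R)^'- => s; exists s.
  by apply/andP; split; near: s; [exact: nbhs_left_gt|exact: nbhs_left_lt].
near: s; apply: cvgr_gt c1; rewrite -[X in _ --> X](expr1n R n).
by apply: cvg_at_left_filter; exact: exprn_continuous.
Unshelve. all: by end_near. Qed.

(** Passage to the limit [s -> 1]: if [b < a], some power [s ^+ n] would exceed [b / a]. *)
Lemma le_exprn_approx {R : realType} n (a b : R) : 0 <= b ->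
  (forall s, 0 < s < 1 -> s ^+ n * a <= b) -> a <= b.
Proof.
move=> b0 ab; rewrite leNgt; apply/negP => ba.
have a0 : 0 < a by exact: le_lt_trans ba.
have [|s s01] := @exprn_lt1_approx R n (b / a); first by rewrite ltr_pdivrMr// mul1r.
by rewrite ltr_pdivrMr// ltNge ab.
Qed.

(** * Cones and truncated cones on the unit ball of the sup norm *)

Section unit_ball.
Context {R : realType}.
Variable n : nat.
Let rn (t : n.-tuple R) : R := `|rowt t|.
Let B (s : R) : set (n.-tuple R) := @rowt R n @^-1` ball 0 s.
Let mu : {measure set (n.-tuple R) -> \bar R} := @lebn R n.

Let BE s t : B s t <-> rn t < s.
Proof. by rewrite /B /= -ball_normE/= sub0r normrN. Qed.

Let mB s : measurable (B s).
Proof. by apply: measurable_rowt_open; exact: ball_open. Qed.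

Let muB s : 0 < s -> mu (B s) = ((2 * s) ^+ n)%:E.
Proof. exact: lebn_ball. Qed.

Let muB1 : mu (B 1) = (2 ^+ n)%:E.
Proof. by rewrite muB// mulr1. Qed.

Let measurable_rn : measurable_fun setT rn.
Proof.
apply: (measurability _ (RGenOInfty.measurableE R)) => //= _ [_ [a ->] <-].
rewrite setTI.
rewrite (_ : rn @^-1` _ = @rowt R n @^-1` [set x | a < `|x|]).
  apply: measurable_rowt_open.
  have /= := open_comp (f := fun x : 'rV[R]_n => `|x|) _ (@open_gt R a); apply.
  by move=> x _; exact: norm_continuous.
by apply/seteqP; split=> t /=; rewrite in_itv/= andbT.
Qed.

(** For [s > 0], the cone of slope 1 and height [s] over the ball of radius [s]. All integrals
    needed for sharpness reduce to those of such cones. *)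
Let w s t : R := Num.max (s - rn t) 0.

Let w_ge0 s t : 0 <= w s t.
Proof. by rewrite /w le_max lexx orbT. Qed.

Let measurable_w s : measurable_fun setT (w s).
Proof. by apply: measurable_maxr => //; exact: measurable_funB. Qed.

Let measurable_Ew s A : measurable_fun A (EFin \o w s).
Proof. by apply: measurable_funTS; exact/measurable_EFinP. Qed.

Let w_le s t : 0 <= s -> w s t <= s.
Proof. by move=> s0; rewrite /w ge_max s0 andbT gerBl normr_ge0. Qed.

Let muB1oo : (mu (B 1) < +oo)%E. Proof. by rewrite muB1 ltry. Qed.

Let integrable_w s : 0 <= s -> mu.-integrable (B 1) (EFin \o w s).
Proof.
move=> s0; apply: (bound_integrable (M := s)) => //; first exact: measurable_funTS.
by move=> t _; rewrite ger0_norm ?w_ge0// w_le.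
Qed.

Let integral_w_full s r : s <= r ->
  (\int[mu]_(t in B r) (w s t)%:E = \int[mu]_t (w s t)%:E)%E.
Proof.
move=> sr; rewrite integral_mkcond; apply: eq_integral => t _.
rewrite patchE; case: ifPn => //; rewrite notin_setE BE => /negP.
by rewrite -leNgt => rt; rewrite /w max_r// subr_le0 (le_trans sr).
Qed.

Let measurable_wD s A : measurable_fun A (fun t => (w s t + (1 - s))%:E).
Proof. by apply/measurable_EFinP; apply: measurable_funTS; exact: measurable_funD. Qed.

Let integral_wD s r : s <= 1 ->
  (\int[mu]_(t in B r) (w s t + (1 - s))%:E =
   \int[mu]_(t in B r) (w s t)%:E + (1 - s)%:E * mu (B r))%E.
Proof.
move=> s1; under eq_integral do rewrite EFinD.
rewrite ge0_integralD//; last 3 first.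
- by move=> t _; rewrite lee_fin w_ge0.
- exact: measurable_Ew.
- by move=> t _; rewrite lee_fin subr_ge0.
by rewrite integral_cst.
Qed.

(** The cone [w s] at [t] is [s] times [w 1] at [t / s]; the substitution contributes the other [n]
    factors of [s]. *)
Let integral_w_scale s : 0 < s <= 1 ->
  (\int[mu]_(t in B 1) (w s t)%:E =
   (s ^+ n.+1)%:E * \int[mu]_(t in B 1) (w 1 t)%:E)%E.
Proof.
move=> /andP[s0 s1].
have sV0 : 0 < s^-1 by rewrite invr_gt0.
have [a a0] := @rowt_surj R n 0.
have mw : measurable_fun [set: n.-tuple R] (EFin \o w 1) by exact: measurable_Ew.
rewrite !integral_w_full//.
transitivity (\int[mu]_t (s%:E * (EFin \o w 1) (afft a s^-1 t)))%E.
  apply: eq_integral => t _; rewrite /= -EFinM; congr EFin.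
  rewrite /w /rn rowt_afft a0 add0r normrZ gtr0_norm// maxr_pMr ?ltW//.
  by rewrite mulr0 mulrBr mulr1 mulVKf ?gt_eqF.
rewrite ge0_integralZl//; last 3 first.
- by have := measurableT_comp mw (measurable_afft a s^-1).
- by move=> t _; rewrite lee_fin w_ge0.
- by rewrite lee_fin ltW.
rewrite (ge0_integral_afft a sV0 mw)//; last first.
  by move=> t; rewrite lee_fin w_ge0.
by rewrite muleA -EFinM exprVn invrK -exprS.
Qed.

(* Comparing the cones [w s] and [w 1] determines the integral as s -> 1. *)
Let integral_w1 : (\int[mu]_(t in B 1) (w 1 t)%:E = (2 ^+ n / n.+1%:R)%:E)%E.
Proof.
have := integrable_fin_num (mB 1) (integrable_w ler01).
have := integral_w_scale.
set I := (\int[mu]_(t in B 1) (w 1 t)%:E)%E => Iscale Ifin.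
have I0 : (0 <= I)%E by apply: integral_ge0 => t _; rewrite lee_fin w_ge0.
have [W IE] : exists W, I = W%:E by exists (fine I); rewrite fineK.
have W0 : 0 <= W by rewrite -lee_fin -IE.
rewrite [LHS]IE.
have n1 : 0 < n.+1%:R :> R by rewrite ltr0n.
have geo s : 1 - s ^+ n.+1 = (1 - s) * \sum_(i < n.+1) s ^+ i.
  rewrite -[1 - s ^+ n.+1]opprB subrX1 -mulNr opprB; congr (_ * _).
(* Everywhere [w 1 <= w s + (1 - s)]. Integrating over the unit ball and dividing by [1 - s] turns
   [1 - s ^+ n.+1] into the geometric sum. *)
have upper s : 0 < s < 1 -> W * (\sum_(i < n.+1) s ^+ i) <= 2 ^+ n.
  move=> /andP[s0 s1].
  have : (W%:E <= (s ^+ n.+1 * W)%:E + ((1 - s) * 2 ^+ n)%:E)%E.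
    rewrite EFinM -IE -Iscale ?s0 ?(ltW s1)// EFinM -muB1 -integral_wD ?(ltW s1)// /I.
    apply: ge0_le_integral => //.
    - by move=> t _; rewrite lee_fin w_ge0.
    - exact: measurable_Ew.
    move=> t _; rewrite lee_fin {1}/w ge_max; apply/andP; split.
      have : s - rn t <= w s t by rewrite /w le_max lexx.
      lra.
    by rewrite addr_ge0 ?w_ge0// subr_ge0 ltW.
  rewrite -EFinD lee_fin -lerBlDl -[X in X - _]mul1r -mulrBl geo -mulrA.
  by rewrite ler_pM2l ?subr_gt0// mulrC.
(* On the ball of radius [s] the same comparison is an equality; integrating over this smaller ball
   only loses mass of [w 1]. *)
have lower s : 0 < s < 1 -> s ^+ n * 2 ^+ n <= W * (\sum_(i < n.+1) s ^+ i).
  move=> /andP[s0 s1].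
  have : ((s ^+ n.+1 * W)%:E + ((1 - s) * (2 * s) ^+ n)%:E <= W%:E)%E.
    rewrite EFinM -IE -Iscale ?s0 ?(ltW s1)// EFinM -muB//.
    rewrite integral_w_full ?(ltW s1)// -(@integral_w_full s s)//
      -integral_wD ?(ltW s1)// /I.
    apply: (@le_trans _ _ (\int[mu]_(t in B s) (w 1 t)%:E)%E).
      apply: ge0_le_integral => //.
      - by move=> t _; rewrite lee_fin addr_ge0 ?w_ge0// subr_ge0 ltW.
      - exact: measurable_Ew.
      move=> t /BE ts; rewrite lee_fin /w max_l ?subr_ge0 ?(ltW ts)//.
      by rewrite max_l; lra.
    apply: ge0_subset_integral => //.
    - exact: measurable_Ew.
    - by move=> t _; rewrite lee_fin w_ge0.
    - by move=> t /BE ts; apply/BE; exact: lt_trans s1.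
  rewrite -EFinD lee_fin => H.
  have s1' : 0 < 1 - s by rewrite subr_gt0.
  rewrite -(ler_pM2l s1') [leRHS]mulrCA -geo (mulrBr W) mulr1 lerBrDr (mulrC W) addrC.
  by apply: le_trans H; rewrite lerD2l exprMn (mulrC (s ^+ n)).
(* Each term of the geometric sum lies between [s ^+ n] and 1, so letting [s] tend to 1 squeezes
   [W * n.+1] to [2 ^+ n]. *)
congr EFin; apply/eqP; rewrite eq_le ler_pdivlMr// ler_pdivrMr//; apply/andP; split.
  apply: (@le_exprn_approx _ n); first by rewrite exprn_ge0.
  move=> s s01; apply: le_trans (upper _ s01); rewrite mulrCA.
  apply: ler_wpM2l => //; rewrite mulr_natr -[X in _ *+ X]card_ord -sumr_const.
  apply: ler_sum => i _; case/andP: s01 => s0 s1.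
  by apply: ler_wiXn2l; rewrite ?(ltW s0) ?(ltW s1)// -ltnS.
apply: (@le_exprn_approx _ n); first by rewrite mulr_ge0.
move=> s s01; apply: le_trans (lower _ s01) _.
apply: ler_wpM2l => //; rewrite -[X in _ <= X%:R]card_ord -sumr_const.
apply: ler_sum => i _; case/andP: s01 => s0 s1.
by rewrite exprn_ile1// ?(ltW s0) ?(ltW s1).
Qed.

(** Flat at height -1 up to radius [r], then of slope [a] in the norm. The constant normalizes the
    infimum, leaving [a] free to enforce mean zero. *)
Definition trunc_cone (a r : R) (x : 'rV[R]_n) : R := a * Num.max (`|x| - r) 0 - 1.

(* The integral of [max(|x| - r, 0)] over the unit ball, so that
   [trunc_cone (2 ^+ n / trunc_mass r) r] has mean zero there. *)
Definition trunc_mass (r : R) : R :=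
  2 ^+ n * (1 - r) - (1 - r ^+ n.+1) * (2 ^+ n / n.+1%:R).

Hypothesis n0 : (0 < n)%N.

Lemma trunc_mass_gt0 r : 0 <= r < 1 -> 0 < trunc_mass r.
Proof.
move=> /andP[r0 r1].
have n1 : 0 < n.+1%:R :> R by rewrite ltr0n.
have -> : trunc_mass r = 2 ^+ n * (1 - r) / n.+1%:R * (n.+1%:R - \sum_(i < n.+1) r ^+ i).
  have geo : 1 - r ^+ n.+1 = (1 - r) * \sum_(i < n.+1) r ^+ i.
    by rewrite -[1 - r ^+ n.+1]opprB subrX1 -mulNr opprB.
  by rewrite /trunc_mass geo; field; rewrite gt_eqF.
have e2 : 0 < 2 ^+ n :> R by rewrite exprn_gt0.
rewrite mulr_gt0 ?divr_gt0 ?mulr_gt0 ?subr_gt0//.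
(* The term of index 0 cancels the 1 in [n + 1]; the other [n] terms are at most [r < 1], and there
   is at least one of them. *)
rewrite big_ord_recl expr0 -natr1 addrC ltrD2r.
apply: (@le_lt_trans _ _ (r *+ n)); last by rewrite -[r *+ n]mulr_natr gtr_pMl// ltr0n.
rewrite -[X in _ *+ X]card_ord -sumr_const; apply: ler_sum => i _.
by rewrite exprS ler_piMr// exprn_ile1// ltW.
Qed.

Let measurable_trunc r : measurable_fun setT (fun t => Num.max (rn t - r) 0).
Proof. by apply: measurable_maxr => //; exact: measurable_funB. Qed.

Let integral_trunc r : 0 <= r < 1 ->
  (\int[mu]_(t in B 1) (Num.max (rn t - r) 0)%:E = (trunc_mass r)%:E)%E.
Proof.
move=> /andP[r0 r1].
have Iw : (\int[mu]_(t in B 1) (w r t)%:E = (r ^+ n.+1 * (2 ^+ n / n.+1%:R))%:E)%E.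
  (* The scaling identity needs a positive radius; for [r = 0] the cone is identically zero. *)
  move: r0; rewrite le_eqVlt => /predU1P[<-|r0]; last first.
    by rewrite integral_w_scale ?r0 ?(ltW r1)// integral_w1.
  rewrite expr0n mul0r integral0_eq// => t _; rewrite /w max_r// sub0r oppr_le0.
  exact: normr_ge0.
(* On the unit ball the truncated norm is a constant plus a difference of two cones with known
   integrals. *)
transitivity (\int[mu]_(t in B 1) ((1 - r)%:E + ((w r t)%:E - (w 1 t)%:E)))%E.
  apply: eq_integral => t; rewrite inE BE => t1.
  rewrite -EFinB -EFinD; congr EFin; rewrite /w (@max_l _ _ (1 - _)); last lra.
  by rewrite /Num.max; case: ifPn; case: ifPn; rewrite ?subr_lt0 ?subr_gt0; lra.
rewrite integralD//; last 2 first.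
- by apply: (bound_integrable (M := `|1 - r|)).
- by apply: integrableB => //; exact: integrable_w.
rewrite integral_cst// integralB// ?integrable_w// Iw integral_w1 muB1.
by rewrite -EFinM -EFinB -EFinD; congr EFin; rewrite /trunc_mass; ring.
Qed.

Let norm_conv (x y : 'rV[R]_n) (t : {i01 R}) :
  `|t%:num *: x + (1 - t%:num) *: y| <= t%:num * `|x| + (1 - t%:num) * `|y|.
Proof.
rewrite (le_trans (ler_normD _ _))// !normrZ ger0_norm// ger0_norm//.
Qed.

Lemma convex_set_ball : convex_set (ball (0 : 'rV[R]_n) 1).
Proof.
move=> x y t; rewrite !inE -!ball_normE /= !sub0r !normrN => x1 y1.
apply: (le_lt_trans (norm_conv _ _ _)).
have t0 : 0 <= t%:num by [].
have t1 : 0 <= 1 - t%:num by rewrite subr_ge0.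
pose m := Num.max `|x| `|y|.
have mx : t%:num * `|x| <= t%:num * m by rewrite ler_wpM2l// le_max lexx.
have my : (1 - t%:num) * `|y| <= (1 - t%:num) * m.
  by rewrite ler_wpM2l// le_max lexx orbT.
have m1 : m < 1 by rewrite gt_max x1.
by apply: le_lt_trans m1; lra.
Qed.

(** The truncation [m] is convex and nondecreasing and the norm is convex; a nonnegative slope
    preserves this. *)
Lemma convex_trunc_cone a r D : 0 <= a ->
  convex_function D (trunc_cone a r).
Proof.
move=> a0 t x y _ _; rewrite /trunc_cone.
have t0 : 0 <= t%:num by [].
have t1 : 0 <= (1 - t%:num) by rewrite subr_ge0.
set m := fun z : R => Num.max (z - r) 0.
have key : m `|t%:num *: x + (1 - t%:num) *: y| <=
    t%:num * m `|x| + (1 - t%:num) * m `|y|.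
  rewrite /m ge_max; apply/andP; split.
    apply: (@le_trans _ _ (t%:num * (`|x| - r) + (1 - t%:num) * (`|y| - r))).
      have := norm_conv x y t; lra.
    by apply: lerD; apply: ler_wpM2l => //; rewrite le_max lexx.
  by rewrite addr_ge0// mulr_ge0// le_max lexx orbT.
have := ler_wpM2l a0 key.
change (a * m `|t%:num *: x + (1 - t%:num) *: y| <=
    a * (t%:num * m `|x| + (1 - t%:num) * m `|y|) ->
 a * m `|t%:num *: x + (1 - t%:num) *: y| - 1 <=
  t%:num * (a * m `|x| - 1) + (1 - t%:num) * (a * m `|y| - 1)).
lra.
Qed.

Lemma inf_trunc_cone a r : 0 <= a -> 0 <= r ->
  inf (trunc_cone a r @` ball 0 1) = -1.
Proof.
move=> a0 r0.
have lb : lbound (trunc_cone a r @` ball 0 1) (-1).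
  by move=> _ [x _ <-]; rewrite /trunc_cone lerDr mulr_ge0// le_max lexx orbT.
have mem : (trunc_cone a r @` ball 0 1) (-1).
  exists 0; first exact: ballxx.
  by rewrite /trunc_cone normr0 sub0r max_r ?oppr_le0// mulr0 sub0r.
apply/eqP; rewrite eq_le ge_inf//=; last by exists (-1).
by apply: lb_le_inf => //; exists (-1).
Qed.

Let B_trunc_cone a r : 0 <= r < 1 ->
  integrableRn (ball 0 1) (trunc_cone a r).
Proof.
move=> /andP[r0 r1]; apply: (bound_integrable (M := `|a| + 1)) => //.
- exact: mB.
- apply: measurable_funTS; apply: measurable_funB => //.
  by apply: measurable_funM => //; exact: measurable_trunc.
- move=> t /BE t1; rewrite (le_trans (ler_normB _ _))// normr1 lerD2r normrM.
  rewrite ler_piMr// ger0_norm ?le_max ?lexx ?orbT// ge_max ler01 andbT.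
  by rewrite lerBlDr; move: t1; rewrite /rn; lra.
Qed.

(** With this slope the first term integrates to [2 ^+ n], the volume of the ball, which cancels the
    constant -1. *)
Let integral_trunc_cone r : 0 <= r < 1 ->
  integralRn (ball 0 1) (fun x => (trunc_cone (2 ^+ n / trunc_mass r) r x)%:E) = 0%E.
Proof.
move=> r01; have V0 := trunc_mass_gt0 r01; have /andP[r0 r1] := r01.
rewrite /integralRn /trunc_cone -/(B 1).
under eq_integral do rewrite EFinB EFinM.
have intm : mu.-integrable (B 1) (fun t => (Num.max (`|rowt t| - r) 0)%:E).
  apply: (bound_integrable (M := 1)) => //.
    by apply: measurable_funTS; exact: measurable_trunc.
  move=> t /BE t1; rewrite ger0_norm ?le_max ?lexx ?orbT// ge_max ler01 andbT.
  by rewrite lerBlDr; move: t1; rewrite /rn; lra.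
rewrite integralB//; last 2 first.
- by apply: integrableZl => //; exact: mB.
- by apply: (bound_integrable (M := `|1|)) => //; exact: mB.
rewrite integralZl// [X in (_ * X)%E]integral_trunc// integral_cst// mul1e.
by rewrite [X in (_ - X)%E]muB1 -EFinM divfK ?gt_eqF// subee.
Qed.

Lemma trunc_cone_admissible r (a := 2 ^+ n / trunc_mass r) : 0 <= r < 1 ->
  [/\ open (ball (0 : 'rV[R]_n) 1), bounded_set (ball (0 : 'rV[R]_n) 1),
      convex_set (ball (0 : 'rV[R]_n) 1) & ball (0 : 'rV[R]_n) 1 !=set0] /\
  [/\ convex_function (ball 0 1) (trunc_cone a r),
      integrableRn (ball 0 1) (trunc_cone a r)
    & integralRn (ball 0 1) (fun x => (trunc_cone a r x)%:E) = 0%E].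
Proof.
move=> r01; have V0 := trunc_mass_gt0 r01; split; split.
- exact: ball_open.
- exists 1; split; first exact: num_real.
  move=> M M1 x; rewrite -ball_normE /= sub0r normrN => x1.
  by rewrite ltW// (lt_trans x1).
- exact: convex_set_ball.
- by exists 0; exact: ballxx.
- by apply: convex_trunc_cone; rewrite divr_ge0 ?exprn_ge0// ltW.
- exact: B_trunc_cone.
- exact: integral_trunc_cone.
Qed.

Let avg (phi : 'rV[R]_n -> R) : \bar R :=
  ((lebRn (ball (0%R : 'rV[R]_n) 1%R))^-1 *
   integralRn (ball (0%R : 'rV[R]_n) 1%R) (fun x => (`|phi x|)%:E))%E.

Let avg_trunc_cone r (a := 2 ^+ n / trunc_mass r) : 0 <= r < 1 ->
  exists2 N : R,
    (\int[mu]_(t in B 1) (negp (trunc_cone a r \o @rowt R n) t)%:E)%E = N%:E &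
    avg (trunc_cone a r) = (2 * N / 2 ^+ n)%:E.
Proof.
move=> r01; have [[oB bB cB B0] [cphi intphi phi0]] := trunc_cone_admissible r01.
have [L [N [L0 LE NE AE]]] := avg_negp oB bB B0 intphi phi0.
exists N => //; rewrite /avg AE; suff -> : 2 ^+ n = L by [].
by apply: EFin_inj; rewrite -LE -muB1.
Qed.

(** For [r = 0] the slope is [k^-1] with [k = n / (n + 1)], so the negative part is [w k] divided by
    [k] and its integral is known by scaling. *)
Lemma avg_cone :
  avg (trunc_cone (2 ^+ n / trunc_mass 0) 0) = (2 / n.+1%:R * (n%:R / n.+1%:R) ^+ n)%:E.
Proof.
have n1 : 0 < n.+1%:R :> R by rewrite ltr0n.
have n0' : 0 < n%:R :> R by rewrite ltr0n.
have e2 : 0 < 2 ^+ n :> R by rewrite exprn_gt0.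
pose k : R := n%:R / n.+1%:R.
have k0 : 0 < k by rewrite divr_gt0.
have k1 : k <= 1 by rewrite ler_pdivrMr// mul1r ler_nat.
have aE : 2 ^+ n / trunc_mass 0 = k^-1.
  have -> : trunc_mass 0 = 2 ^+ n * k.
    have n1' : 1 + n%:R != 0 :> R by rewrite nat1r gt_eqF.
    by rewrite /trunc_mass expr0n /= subr0 mulr1 mul1r /k -natr1; field.
  by rewrite invfM mulrA divff ?gt_eqF// mul1r.
have r01 : 0 <= (0 : R) < 1 by rewrite lexx ltr01.
have [N NE ->] := avg_trunc_cone r01; congr EFin.
suff -> : N = k ^+ n * (2 ^+ n / n.+1%:R).
  by rewrite -/k; field; rewrite !gt_eqF.
apply: EFin_inj; rewrite -NE aE.
transitivity (\int[mu]_(t in B 1) (k^-1%:E * (w k t)%:E))%E.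
  apply: eq_integral => t _; rewrite -EFinM; congr EFin.
  rewrite /negp /trunc_cone /= subr0 (@max_l _ _ `|rowt t|)//.
  by rewrite /w maxr_pMr ?invr_ge0 ?(ltW k0)// mulr0 opprB mulrBr mulVf ?gt_eqF.
rewrite integralZl//; last by apply: integrable_w; exact: ltW.
rewrite integral_w_scale ?k0// integral_w1 -!EFinM exprS; congr EFin.
by rewrite -(mulrA k) mulKf ?gt_eqF.
Qed.

(** The negative part equals 1 on the ball of radius [r], so its integral is at least
    [(2 * r) ^+ n]. *)
Lemma avg_trunc_cone_ge r : 0 < r < 1 ->
  ((2 * r ^+ n)%:E <= avg (trunc_cone (2 ^+ n / trunc_mass r) r))%E.
Proof.
move=> /andP[r0 r1]; have r01 : 0 <= r < 1 by rewrite ltW.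
have [[oB bB cB B0] [cphi intphi phi0]] := trunc_cone_admissible r01.
have e2 : 0 < 2 ^+ n :> R by rewrite exprn_gt0.
have [N NE ->] := avg_trunc_cone r01.
rewrite lee_fin ler_pdivlMr// -mulrA ler_pM2l// mulrC -exprMn -lee_fin -muB// -NE.
set g := negp _.
have mEg : measurable_fun (B 1) (EFin \o g).
  apply/measurable_EFinP.
  exact: (@measurable_negp _ _ _ mu _ (trunc_cone _ r \o @rowt R n) intphi).
have Br1 : B r `<=` B 1 by move=> t /BE tr; apply/BE; exact: lt_trans r1.
rewrite -[leLHS]mul1e -integral_cst//.
apply: (@le_trans _ _ (\int[mu]_(t in B r) (g t)%:E)%E).
  apply: ge0_le_integral => //.
  - exact: (measurable_funS _ Br1 mEg).
  - move=> t /BE tr; rewrite lee_fin /g /negp /trunc_cone /=.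
    by rewrite (@max_r _ _ (_ - r)) ?subr_le0 ?(ltW tr)// mulr0 sub0r opprK le_max lexx.
apply: ge0_subset_integral => //.
by move=> t _; rewrite lee_fin negp_ge0.
Qed.

End unit_ball.

(** * The estimate together with the sharpness of both constants *)

Unset Implicit Arguments.

Theorem theorem1p2 (R : realType) (n : nat) (hn : (0 < n)%N) :
  let C : R := 2 / n.+1%:R * (n%:R / n.+1%:R) ^+ n in
  let hyp := fun (P : set 'rV[R]_n) (phi : 'rV[R]_n -> R) =>
    [/\ open P, bounded_set P, convex_set P & P !=set0] /\
    [/\ convex_function P phi, integrableRn P phi
      & integralRn P (fun x => (phi x)%:E) = 0%E] in
  let avg := fun (P : set 'rV[R]_n) (phi : 'rV[R]_n -> R) =>
    ((lebRn P)^-1 * integralRn P (fun x => (`|phi x|)%:E))%E in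
  (forall P phi, hyp P phi ->
      ((- C * inf (phi @` P))%:E <= avg P phi)%E /\
      (avg P phi <= (- 2 * inf (phi @` P))%:E)%E) /\
  (forall c : R, C < c -> exists P phi,
      hyp P phi /\ (avg P phi < (- c * inf (phi @` P))%:E)%E) /\
  (forall c : R, c < 2 -> exists P phi,
      hyp P phi /\ ((- c * inf (phi @` P))%:E < avg P phi)%E).
Proof.
move=> C hyp avg.
have infE r : 0 <= r < 1 ->
    inf (trunc_cone (2 ^+ n / trunc_mass n r) r @` ball (0 : 'rV[R]_n) 1) = -1.
  move=> r01; have /andP[r0 _] := r01; apply: inf_trunc_cone => //.
  by rewrite divr_ge0 ?exprn_ge0// ltW// trunc_mass_gt0.
split=> [P phi [[oP bP cP P0] [cphi intphi phi0]]|].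
  by apply/andP; exact: mean_oscillation_bounds.
split=> c hc.
  (* The full cone has infimum -1 and average exactly [C], hence below any [c > C]. *)
  have r01 : 0 <= (0 : R) < 1 by rewrite lexx ltr01.
  exists (ball 0 1), (trunc_cone (2 ^+ n / trunc_mass n 0) 0).
  split; first exact: trunc_cone_admissible.
  by rewrite infE// mulrN1 opprK /avg avg_cone// lte_fin.
(* The radius is chosen with [r ^+ n > c / 2], so that the bound [2 * r ^+ n] on the average exceeds
   [c]. *)
have [|r r01 cr] := @exprn_lt1_approx R n (c / 2).
  by rewrite ltr_pdivrMr// mul1r.
have r01' : 0 <= r < 1 by case/andP: r01 => /ltW -> ->.
exists (ball 0 1), (trunc_cone (2 ^+ n / trunc_mass n r) r).
split; first exact: trunc_cone_admissible.
rewrite infE// mulrN1 opprK; apply: lt_le_trans (avg_trunc_cone_ge hn r01).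
by rewrite lte_fin mulrC -ltr_pdivrMr.
Qed.
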